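(* The following recursions hold: (a) $M(T_k)=M(A_{k-1})^2+M(Y_k)$ for $k\ge2$, with $M(T_1)=1$; (b) $M(A_k)=M(T_k)+2M(X_k)+M(T_{k-1})^2$ for $k\ge2$, with $M(A_1)=1$; (c) $M(X_k)=M(T_{k-1})\sqrt{M(Z_k)}$ for $k\ge2$, with $M(X_1)=1$; (d) $M(Y_k)=2M(Z_{k-1})M(T_{k-1})-M(Z_{k-1})^2$ for $k\ge2$, with $M(Y_1)=1$; (e) $M(Z_k)=\left(2M(X_{k-1})+M(T_{k-2})^2+M(Z_{k-1})\right)^2$ for $k\ge3$, with $M(Z_1)=M(Z_2)=1$.
   Context: A DAG with skeleton $G$ (a finite simple undirected graph) is an acyclic orientation of all edges of $G$. An immorality in a DAG is an induced subgraph $i\to j\leftarrow k$ (so $i,k$ are nonadjacent); $j$ is its head. Two DAGs are Markov equivalent iff they have the same skeleton and the same set of immoralities; a Markov equivalence class (MEC) with skeleton $G$ is an equivalence class of DAGs with skeleton $G$. $M(G)$ denotes the total number of MECs with skeleton $G$. For $k\ge1$, $T_k$ is the complete binary tree with $2^k-1$ nodes (rooted; every nonleaf node has two children and all leaves are at the same depth; $T_1$ is a single node). $A_k$ is the additive tree with $2^k$ nodes obtained from $T_k$ by attaching one leaf $r$ to the root $c$ of $T_k$; $r$ is regarded as the root of $A_k$ and $c$ as its unique child. $X_k$ ($k\ge2$) is the partially directed tree with skeleton $A_k$ having exactly one immorality at $c$, this being $r\to c\leftarrow u$ where $u$ is one fixed child of $c$ (so $c\to v$ for the other child $v$); $M(X_k)$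 is the number of MECs of DAGs with skeleton $A_k$ containing these directed edges. By convention $M(X_1)=1$. $M(Y_k)$ is the number of MECs with skeleton $T_k$ in which no edge incident to the root is involved in any immorality. $M(Z_k)$ is the number of MECs of DAGs with skeleton $A_k$ in which $r\to c$ and $c$ is directed to each of its children. *)

(* Defs.v *)
From mathcomp Require Import all_boot.

Set Implicit Arguments.
Unset Strict Implicit.
Unset Printing Implicit Defensive.

Record sgraph := SGraph {
  vertex :> finType;
  edge : rel vertex;
  edge_sym : symmetric edge;
  edge_irrefl : irreflexive edge
}.

(* A directed graph on V is given by its set of arcs: (i, j) \in D is i -> j. *)
Section Digraphs.
Variable V : finType.
Implicit Type D : {set V * V}.

Definition arc D : rel V := fun i j => (i, j) \in D.

Definition skeleton D : {set V * V} :=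
  [set p | arc D p.1 p.2 || arc D p.2 p.1].

(* In particular no loops, and no pair of opposite arcs. *)
Definition acyclic D : bool :=
  [forall i, forall j, arc D i j ==> ~~ connect (arc D) j i].

(* (i, j, k) stands for i -> j <- k; both (i, j, k) and (k, j, i) occur. *)
Definition immoralities D : {set V * V * V} :=
  [set t : V * V * V | let: (i, j, k) := t in
     [&& arc D i j, arc D k j, i != k & (i, k) \notin skeleton D]].

Definition markov_equiv : rel {set V * V} := fun D1 D2 =>
  (skeleton D1 == skeleton D2) && (immoralities D1 == immoralities D2).

Lemma markov_equiv_equivalence : equivalence_rel markov_equiv.
Proof.
by rewrite /markov_equiv => D1 D2 D3; split=> [|/andP[/eqP-> /eqP->]];
  rewrite ?eqxx.
Qed.

End Digraphs.

Definition dags (G : sgraph) : {set {set G * G}} :=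
  [set D : {set G * G} |
    acyclic D && (skeleton D == [set p : G * G | edge p.1 p.2])].

Definition MECs (G : sgraph) : {set {set {set G * G}}} :=
  equivalence_partition (@markov_equiv G) (dags G).

Definition M (G : sgraph) : nat := #|MECs G|.

(* None is the root; inl and inr are the left and right subtrees. *)
Fixpoint tree_vertex (k : nat) : finType :=
  if k is k'.+1 then option (tree_vertex k' + tree_vertex k')%type else void.

Definition is_root (k : nat) : pred (tree_vertex k) :=
  match k return pred (tree_vertex k) with
  | 0 => fun _ => false
  | k'.+1 => fun x => x == None
  end.

(* y is a child of x *)
Fixpoint is_child (k : nat) : rel (tree_vertex k) :=
  match k return rel (tree_vertex k) with
  | 0 => fun _ _ => false
  | k'.+1 => fun x y =>
    match x, y with
    | None, Some (inl y') => is_root y'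
    | None, Some (inr y') => is_root y'
    | Some (inl x'), Some (inl y') => is_child x' y'
    | Some (inr x'), Some (inr y') => is_child x' y'
    | _, _ => false
    end
  end.

Definition tree_edge (k : nat) : rel (tree_vertex k) :=
  fun x y => is_child x y || is_child y x.

Lemma tree_edge_sym k : symmetric (@tree_edge k).
Proof. by move=> x y; rewrite /tree_edge orbC. Qed.

Lemma tree_edge_irrefl k : irreflexive (@tree_edge k).
Proof.
move=> x; rewrite /tree_edge orbb.
by elim: k x => [|k IHk] // [[x|x]|] //=.
Qed.

Definition T (k : nat) : sgraph :=
  SGraph (@tree_edge_sym k) (@tree_edge_irrefl k).

Lemma card_T k : #|T k| = 2 ^ k - 1.
Proof.
rewrite /=; elim: k => [|k IHk]; first by rewrite card_void.
rewrite /= card_option card_sum IHk expnS.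
by case: (2 ^ k) (expn_gt0 2 k) => // n _; rewrite mul2n -addnn !subn1 /= addnS.
Qed.

(* None is the extra leaf r. *)
Definition additive_edge (k : nat) : rel (option (tree_vertex k)) :=
  fun x y => match x, y with
  | None, Some y' => is_root y'
  | Some x', None => is_root x'
  | Some x', Some y' => tree_edge x' y'
  | None, None => false
  end.

Lemma additive_edge_sym k : symmetric (@additive_edge k).
Proof. by move=> [x|] [y|] //=; rewrite tree_edge_sym. Qed.

Lemma additive_edge_irrefl k : irreflexive (@additive_edge k).
Proof. by move=> [x|] //=; rewrite tree_edge_irrefl. Qed.

Definition A (k : nat) : sgraph :=
  SGraph (@additive_edge_sym k) (@additive_edge_irrefl k).

Lemma card_A k : #|A k| = 2 ^ k.
Proof.
by rewrite [LHS]card_option (card_T k) subn1 prednK ?expn_gt0.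
Qed.

(* The left (b = false) or right (b = true) child of c, the child of r. *)
Definition X_child (n : nat) (b : bool) : A n.+2 :=
  Some (Some (if b then inr None else inl None)).

(* The arcs r -> c, u -> c, c -> v, where u is the child of c selected by b. *)
Definition X_arcs (n : nat) (b : bool) : {set A n.+2 * A n.+2} :=
  let r : A n.+2 := None in
  let c : A n.+2 := Some None in
  [set (r, c); (X_child n b, c); (c, X_child n (~~ b))].

(* M(X_1) = 1 is a convention; the value at k = 0 is junk. Since r, u, v are
   the only neighbours of c, X_arcs leaves r -> c <- u as the only immorality
   at c. *)
Definition MX (b : bool) (k : nat) : nat :=
  if k is n.+2 then
    #|[set C in MECs (A n.+2) | [exists D in C, X_arcs n b \subset D]]|
  else 1.

(* An immorality x -> y <- z uses an edge at the root iff one of x, y, z is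
   the root. *)
Definition Y_dag (k : nat) (D : {set T k * T k}) : bool :=
  [forall t in immoralities D, let: (x, y, z) := t in
     ~~ [|| @is_root k x, @is_root k y | @is_root k z]].

Definition MY (k : nat) : nat :=
  #|[set C in MECs (T k) | [forall D in C, Y_dag D]]|.

Definition Z_dag (k : nat) (D : {set A k * A k}) : bool :=
  [forall c : tree_vertex k, is_root c ==>
     arc D None (Some c) &&
     [forall u : tree_vertex k, is_child c u ==> arc D (Some c) (Some u)]].

(* A class is counted when some DAG in it has these arcs: they take part in no
   immorality at c, so other DAGs of the class may orient them differently. *)
Definition MZ (k : nat) : nat :=
  #|[set C in MECs (A k) | [exists D in C, Z_dag D]]|.

(* Main.v *)
Require Import Defs.
From mathcomp Require Import all_boot all_order all_algebra.
From Stdlib Require Import Lia.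
From mathcomp Require Import zify.
Import Order.TTheory GRing.Theory Num.Theory.

(** A class of DAGs with a fixed skeleton is a set of immoralities, so every
    quantity of the theorem is the number of immorality sets realised by some
    family of DAGs. A tree has no cycle, so the DAGs on [A k] are exactly the
    orientations of its edges, and those on [T k] are the orientations of [A k]
    in which the extra edge points from the root c to the leaf r: such an edge
    takes part in no immorality ([M_A], [M_T]).

    The edges at c split [A k.+1] into the edge rc and two copies of [A k], one
    per branch, in which c plays the part of r. Immoralities with head c depend
    only on the directions of the three edges at c, all others lie in one of
    the two branches. Hence an immorality set is faithfully coded by the
    immoralities at c together with the codes of the two branches
    ([immo_code]).

    Let O and I be the sets of codes of the orientations of a branch whose top
    edge points out of the branch, respectively into it. Then |O| = M(T_k),
    |O u I| = M(A_k), and |I|^2 counts the next Z. Prescribing the directions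
    of the edges at c gives a product of two of the sets O and I
    ([codes_block]), which yields X and Z at once, and the codes one level up
    form a union of such products ([in_codesS]). The products with an immorality
    involving r are pairwise disjoint ([card_parent_blocks]), which gives (b)
    and (e). The codes without immorality at c are the pairs in
    I x I u O x I u I x O, that is, the pairs of elements of O u I that are not
    both forced to point out. These pairs and O x O have union (O u I)^2 and
    the Y-classes as intersection, which is (a); those in O x O are all of O x O
    except the square of O minus I, which is (d) because |O n I| = M(Z_k)
    ([card_free_out]). *)

Set Implicit Arguments.
Unset Strict Implicit.
Unset Printing Implicit Defensive.

Local Open Scope nat_scope.
Local Notation arc := Defs.arc.

(** * Counting classes by their immoralities *)

Lemma card_imset_fibers (I X Y : finType) (f : I -> X) (g : I -> Y)
    (P : {set I}) :
  {in P &, forall i j, f i = f j <-> g i = g j} -> #|f @: P| = #|g @: P|.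
Proof.
move=> fg; pose h i := (f i, g i).
have -> : f @: P = fst @: (h @: P) by rewrite -imset_comp.
have -> : g @: P = snd @: (h @: P) by rewrite -imset_comp.
transitivity #|h @: P|; [|symmetry]; apply: card_in_imset.
- move=> x y /imsetP[i iP ->] /imsetP[j jP ->] /= fij.
  by rewrite /h fij (proj1 (fg i j iP jP) fij).
- move=> x y /imsetP[i iP ->] /imsetP[j jP ->] /= gij.
  by rewrite /h gij (proj2 (fg i j iP jP) gij).
Qed.

Lemma dag_skeleton (G : sgraph) (D : {set G * G}) x y :
  D \in dags G -> arc D x y || arc D y x = edge x y.
Proof.
by rewrite inE => /andP[_ /eqP/setP/(_ (x, y))]; rewrite !inE.
Qed.

Lemma dag_asym (G : sgraph) (D : {set G * G}) x y :
  D \in dags G -> arc D x y -> ~~ arc D y x.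
Proof.
rewrite inE => /andP[/forallP/(_ x)/forallP/(_ y)/implyP acD _] /acD.
by apply: contra; apply: connect1.
Qed.

Lemma in_immoralities (G : sgraph) (D : {set G * G}) x y z :
  D \in dags G ->
  ((x, y, z) \in immoralities D) =
    [&& arc D x y, arc D z y, x != z & ~~ edge x z].
Proof. by move=> dagD; rewrite !inE /= dag_skeleton. Qed.

(** The bridge from classes to codes: once a family of DAGs is parametrised by
    [D] and [code] separates exactly the immorality sets, classes that meet the
    family are in bijection with the codes that occur. *)
Lemma card_MECs_code (G : sgraph) (Q : pred {set G * G})
    (I C : finType) (D : I -> {set G * G}) (code : I -> C) (P : pred I) :
    (forall i, P i -> D i \in dags G /\ Q (D i)) ->
    (forall E, E \in dags G -> Q E -> exists2 i, P i & D i = E) ->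
    (forall i j, P i -> P j ->
       immoralities (D i) = immoralities (D j) <-> code i = code j) ->
  #|[set C in MECs G | [exists E in C, Q E]]| = #|code @: [set i | P i]|.
Proof.
move=> Ddag Dsurj Dcode.
pose cls E := [set E' in dags G | markov_equiv E E'].
have clsP E E' : E \in dags G -> E' \in dags G ->
    cls E = cls E' <-> immoralities E = immoralities E'.
  move=> dE dE'; have [/eqP sE /eqP sE'] :
      skeleton E == [set p : G * G | edge p.1 p.2] /\
      skeleton E' == [set p : G * G | edge p.1 p.2].
    by move: dE dE'; rewrite !inE => /andP[_ ->] /andP[_ ->].
  split=> [eqC|eqi].
    have: E' \in cls E by rewrite eqC inE dE' /markov_equiv !eqxx.
    by rewrite inE => /and3P[_ _ /eqP].
  by apply/setP=> F; rewrite !inE /markov_equiv sE sE' eqi.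
have -> : [set C in MECs G | [exists E in C, Q E]] =
    (fun i => cls (D i)) @: [set i | P i].
  apply/setP=> F; rewrite inE; apply/andP/imsetP.
    case=> /imsetP[E dE ->] /existsP[E' /andP[]].
    rewrite inE => /andP[dE' eqE] QE'.
    have [i Pi DE'] := Dsurj _ dE' QE'; exists i; rewrite ?inE //.
    rewrite DE'; apply/(clsP _ _ dE dE').
    by move: eqE => /andP[_ /eqP].
  case=> i; rewrite inE => Pi ->; have [dD QD] := Ddag i Pi.
  split; first by apply/imsetP; exists (D i).
  by apply/existsP; exists (D i); rewrite QD inE dD /markov_equiv !eqxx.
apply: card_imset_fibers => i j; rewrite !inE => Pi Pj.
have [[dDi _] [dDj _]] := (Ddag i Pi, Ddag j Pj).
by split=> [/(clsP _ _ dDi dDj)/Dcode|/Dcode/(clsP _ _ dDi dDj)]; apply.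
Qed.

Lemma card_MECs_all (G : sgraph) :
  M G = #|[set C in MECs G | [exists E in C, predT E]]|.
Proof.
apply: eq_card => C; rewrite inE andb_idr // => /imsetP[E dE ->].
by apply/existsP; exists E; rewrite inE dE /markov_equiv !eqxx.
Qed.

(** * Orientations of the additive tree *)

(** The boolean is the direction of the edge between the root of the tree and
    its parent r, [true] meaning that it points to r; the two components are the
    orientations of the branches, each with the edge above its root. *)
Fixpoint orientation (k : nat) : finType :=
  if k is k'.+1 then (bool * (orientation k' * orientation k'))%type else unit.

Definition lbranch k (o : orientation k.+1) : orientation k := o.2.1.
Definition rbranch k (o : orientation k.+1) : orientation k := o.2.2.
Arguments lbranch k !o /.
Arguments rbranch k !o /.

(** The value at 0 says that an absent child is not a parent, so leaves need no
    special treatment in what follows. *)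
Definition up (k : nat) : pred (orientation k) :=
  match k return pred (orientation k) with
  | 0 => fun _ => false
  | k'.+1 => fun o => o.1
  end.

Fixpoint oarc (k : nat) : orientation k -> rel (option (tree_vertex k)) :=
  match k return orientation k -> rel (option (tree_vertex k)) with
  | 0 => fun _ _ _ => false
  | k'.+1 => fun o x y =>
    match x, y with
    | None, Some None => ~~ o.1
    | Some None, None => o.1
    | Some None, Some (Some (inl y')) => oarc (lbranch o) None (Some y')
    | Some None, Some (Some (inr y')) => oarc (rbranch o) None (Some y')
    | Some (Some (inl x')), Some None => oarc (lbranch o) (Some x') None
    | Some (Some (inr x')), Some None => oarc (rbranch o) (Some x') None
    | Some (Some (inl x')), Some (Some (inl y')) =>
        oarc (lbranch o) (Some x') (Some y')
    | Some (Some (inr x')), Some (Some (inr y')) =>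
        oarc (rbranch o) (Some x') (Some y')
    | _, _ => false
    end
  end.

(** Each branch of the root c, with c added as its leaf r, is a copy of [A k]
    inside [A k.+1]. *)
Definition inL k (x : option (tree_vertex k)) : option (tree_vertex k.+1) :=
  if x is Some x' then Some (Some (inl x')) else Some None.

Definition inR k (x : option (tree_vertex k)) : option (tree_vertex k.+1) :=
  if x is Some x' then Some (Some (inr x')) else Some None.

Lemma oarc_NN k (o : orientation k) : oarc o None None = false.
Proof. by case: k o. Qed.

Lemma oarc_inL k (o : orientation k.+1) x y :
  oarc o (inL x) (inL y) = oarc (lbranch o) x y.
Proof. by case: x y => [x|] [y|] //=; rewrite oarc_NN. Qed.

Lemma oarc_inR k (o : orientation k.+1) x y :
  oarc o (inR x) (inR y) = oarc (rbranch o) x y.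
Proof. by case: x y => [x|] [y|] //=; rewrite oarc_NN. Qed.

Lemma edge_inL k x y : edge (inL x : A k.+1) (inL y) = edge (x : A k) y.
Proof. by case: x y => [x|] [y|] //=; rewrite /tree_edge /= ?orbF. Qed.

Lemma edge_inR k x y : edge (inR x : A k.+1) (inR y) = edge (x : A k) y.
Proof. by case: x y => [x|] [y|] //=; rewrite /tree_edge /= ?orbF. Qed.

Lemma oarc_None_l k (o : orientation k) y :
  oarc o None y = if y is Some y' then is_root y' && ~~ up o else false.
Proof. by case: k o y => [|k] o [y|] //; case: y => [[y|y]|]. Qed.

Lemma oarc_None_r k (o : orientation k) x :
  oarc o x None = if x is Some x' then is_root x' && up o else false.
Proof. by case: k o x => [|k] o [x|] //; case: x => [[x|x]|]. Qed.

(** The two copies of [A k] meet only in c and their other vertices are not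
    adjacent across copies, so an edge lies in one copy or contains r. *)
Variant pair_spec k : option (tree_vertex k.+1) -> option (tree_vertex k.+1) ->
    Prop :=
  | PairL x y : pair_spec (inL x) (inL y)
  | PairR x y : pair_spec (inR x) (inR y)
  | PairLR x y : pair_spec (inL (Some x)) (inR (Some y))
  | PairRL x y : pair_spec (inR (Some x)) (inL (Some y))
  | Pairr_ y : pair_spec None y
  | Pair_r x : pair_spec x None.

Lemma pairP k x y : @pair_spec k x y.
Proof.
case: x y => [[[x|x]|]|] [[[y|y]|]|]; try exact: Pairr_; try exact: Pair_r.
- exact: (PairL (Some x) (Some y)).
- exact: PairLR.
- exact: (PairL (Some x) None).
- exact: PairRL.
- exact: (PairR (Some x) (Some y)).
- exact: (PairR (Some x) None).
- exact: (PairL None (Some y)).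
- exact: (PairR None (Some y)).
- exact: (PairL None None).
Qed.

Lemma oarc_edge k (o : orientation k) x y :
  oarc o x y || oarc o y x = edge (x : A k) y.
Proof.
elim: k o x y => [|k IHk] o x y; first by case: x y => [[]|] [[]|].
case: (pairP x y) => {x y} [x y|x y|x y|x y|y|x].
- by rewrite !oarc_inL IHk edge_inL.
- by rewrite !oarc_inR IHk edge_inR.
- by [].
- by [].
- by case: y => [[[y|y]|]|] //=; case: (o.1).
- by case: x => [[[x|x]|]|] //=; case: (o.1).
Qed.

(** Level of a vertex when r is at level 0 and each arc climbs by one. It exists
    because a tree has no cycle, and it certifies acyclicity. *)
Fixpoint level (k : nat) : orientation k -> tree_vertex k -> int :=
  match k return orientation k -> tree_vertex k -> int with
  | 0 => fun _ _ => 0%R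
  | k'.+1 => fun o x =>
    ((-1) ^+ o.1 + match x with
    | None => 0
    | Some (inl x') => level (lbranch o) x'
    | Some (inr x') => level (rbranch o) x'
    end)%R
  end.

Lemma oarc_level k (o : orientation k) x y :
  oarc o x y -> (oapp (level o) 0 x < oapp (level o) 0 y)%R.
Proof.
elim: k o x y => [|k IHk] o x y //.
have lL z : oapp (level o) 0%R (inL z) =
    ((-1) ^+ o.1 + oapp (level (lbranch o)) 0 z)%R.
  by case: z.
have lR z : oapp (level o) 0%R (inR z) =
    ((-1) ^+ o.1 + oapp (level (rbranch o)) 0 z)%R.
  by case: z.
case: (pairP x y) => {x y} [x y|x y|x y|x y|y|x] //.
- by rewrite oarc_inL !lL ltrD2l; apply: IHk.
- by rewrite oarc_inR !lR ltrD2l; apply: IHk.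
- by case: y => [[[y|y]|]|] //=; case: (o.1).
- by case: x => [[[x|x]|]|] //=; case: (o.1).
Qed.

Lemma acyclic_level (V : finType) (D : {set V * V}) (h : V -> int) :
  (forall x y, arc D x y -> (h x < h y)%R) -> acyclic D.
Proof.
move=> hD; apply/'forall_forallP => x y; apply/implyP=> /hD ltxy.
apply/negP=> /connectP[p Dp xE]; suff: (h y <= h x)%R by rewrite leNgt ltxy.
elim: p y Dp xE {ltxy} => [|z p IHp] y /=; first by move=> _ ->.
by move=> /andP[/hD/ltW yz /IHp{}IHp /IHp]; apply: le_trans.
Qed.

(** Antisymmetry suffices because the skeleton is a tree; the bits of the
    orientation are read off branch by branch. *)
Lemma oarc_surj k (D : rel (A k)) :
    (forall x y, D x y || D y x = edge x y) ->
    (forall x y, D x y -> ~~ D y x) ->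
  exists o : orientation k, D =2 oarc o.
Proof.
elim: k D => [|k IHk] D skD asD.
  exists tt => x y; apply/negbTE.
  by have := skD x y; case: x y => [[]|] [[]|]; case: (D _ _).
have [|x y|l lE] := IHk (fun x y => D (inL x) (inL y)).
- by move=> x y; rewrite skD edge_inL.
- exact: asD.
have [|x y|r rE] := IHk (fun x y => D (inR x) (inR y)).
- by move=> x y; rewrite skD edge_inR.
- exact: asD.
exists (D (Some None) None, (l, r)) => x y.
have nE u v : edge u v = false -> D u v = false.
  by rewrite -skD; case: (D u v).
case: (pairP x y) => {x y} [x y|x y|x y|x y|y|x].
- by rewrite oarc_inL -lE.
- by rewrite oarc_inR -rE.
- by rewrite nE.
- by rewrite nE.
- case: y => [[[y|y]|]|] /=; [by rewrite nE.. | | by rewrite nE].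
  have := skD (Some None) None; have := asD (Some None) None.
  by case: (D (Some None) None) => [/(_ isT)/negbTE|_ /=].
- by case: x => [[[x|x]|]|] //=; rewrite nE.
Qed.

Definition arcsA k (o : orientation k) : {set A k * A k} :=
  [set p | oarc o p.1 p.2].

Definition arcsT k (o : orientation k) : {set T k * T k} :=
  [set p | oarc o (Some p.1) (Some p.2)].

Lemma arcA k (o : orientation k) x y : arc (arcsA o) x y = oarc o x y.
Proof. by rewrite /arc inE. Qed.

Lemma arcT k (o : orientation k) x y :
  arc (arcsT o) x y = oarc o (Some x) (Some y).
Proof. by rewrite /arc inE. Qed.

Lemma arcsA_dag k (o : orientation k) : arcsA o \in dags (A k).
Proof.
rewrite inE; apply/andP; split.
  apply: (@acyclic_level _ _ (oapp (level o) 0%R)) => x y.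
  by rewrite arcA => /oarc_level.
by apply/eqP/setP=> -[x y]; rewrite !inE !arcA oarc_edge.
Qed.

Lemma arcsT_dag k (o : orientation k) : arcsT o \in dags (T k).
Proof.
rewrite inE; apply/andP; split.
  by apply: (@acyclic_level _ _ (level o)) => x y; rewrite arcT => /oarc_level.
by apply/eqP/setP=> -[x y]; rewrite !inE !arcT oarc_edge.
Qed.

Lemma arcsA_surj k (D : {set A k * A k}) :
  D \in dags (A k) -> exists o : orientation k, arcsA o = D.
Proof.
move=> dD; have [x y|x y|o oE] := @oarc_surj k (arc D).
- exact: dag_skeleton.
- exact: dag_asym.
- by exists o; apply/setP=> -[x y]; rewrite inE /= -oE.
Qed.

(** Adding the arc from the root to r turns an orientation of [T k.+1] into one
    of [A k.+1]. *)
Lemma arcsT_surj k (D : {set T k.+1 * T k.+1}) :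
  D \in dags (T k.+1) -> exists2 o : orientation k.+1, up o & arcsT o = D.
Proof.
move=> dD; have [||o oE] := @oarc_surj k.+1 (fun x y =>
    match x, y with
    | Some x', Some y' => arc D x' y'
    | Some x', None => is_root x'
    | _, _ => false
    end).
- by move=> [x|] [y|] //=; rewrite ?orbF //; apply: (@dag_skeleton (T k.+1)).
- by move=> [x|] [y|] // Dxy; apply: (@dag_asym (T k.+1) D).
exists o; first by have := oE (Some None) None.
by apply/setP=> -[x y]; rewrite inE -(oE (Some x) (Some y)).
Qed.

(** * Coding immorality sets *)

Definition immo k (o : orientation k) (x y z : option (tree_vertex k)) :=
  [&& oarc o x y, oarc o z y, x != z & ~~ edge (x : A k) z].

Lemma in_immA k (o : orientation k) x y z :
  ((x, y, z) \in immoralities (arcsA o)) = immo o x y z.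
Proof. by rewrite in_immoralities ?arcsA_dag // !arcA. Qed.

Lemma in_immT k (o : orientation k) x y z :
  ((x, y, z) \in immoralities (arcsT o)) = immo o (Some x) (Some y) (Some z).
Proof. by rewrite in_immoralities ?arcsT_dag // !arcT. Qed.

Lemma immo_inL k (o : orientation k.+1) x y z :
  immo o (inL x) (inL y) (inL z) = immo (lbranch o) x y z.
Proof. by rewrite /immo !oarc_inL edge_inL; case: x z => [?|] [?|]. Qed.

Lemma immo_inR k (o : orientation k.+1) x y z :
  immo o (inR x) (inR y) (inR z) = immo (rbranch o) x y z.
Proof. by rewrite /immo !oarc_inR edge_inR; case: x z => [?|] [?|]. Qed.

Lemma root_uniq k (x y : tree_vertex k) : is_root x -> is_root y -> x = y.
Proof. by case: k x y => //= k x y /eqP-> /eqP->. Qed.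

Lemma immo_None_mid k (o : orientation k) x z : immo o x None z = false.
Proof.
rewrite /immo !oarc_None_r; case: x z => [x|] [z|] //=; rewrite ?andbF //.
apply/and4P=> -[/andP[rx _] /andP[rz _] /eqP[]].
by congr Some; apply: root_uniq.
Qed.

Fixpoint code_type (k : nat) : finType :=
  if k is k'.+1 then (bool * bool * bool * (code_type k' * code_type k'))%type
  else unit.

(** When p, l, r tell whether the parent, the left child and the right child of
    a vertex point to it, these are the three possible immoralities there:
    parent-left, parent-right and left-right. *)
Definition collisions (p l r : bool) := (p && l, p && r, l && r).

Fixpoint code (k : nat) : orientation k -> code_type k :=
  match k return orientation k -> code_type k with
  | 0 => fun _ => tt
  | k'.+1 => fun o =>
    (collisions (~~ o.1) (up (lbranch o)) (up (rbranch o)),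
     (code (lbranch o), code (rbranch o)))
  end.

(** The head c has at most three neighbours, pairwise nonadjacent, so two
    arcs from distinct neighbours always form an immorality. *)
Lemma immo_mid k (o : orientation k.+1) x z :
  immo o x (Some None) z =
  match x, z with
  | None, Some (Some (inl z')) => is_root z' && (~~ o.1 && up (lbranch o))
  | Some (Some (inl x')), None => is_root x' && (~~ o.1 && up (lbranch o))
  | None, Some (Some (inr z')) => is_root z' && (~~ o.1 && up (rbranch o))
  | Some (Some (inr x')), None => is_root x' && (~~ o.1 && up (rbranch o))
  | Some (Some (inl x')), Some (Some (inr z')) =>
      is_root x' && is_root z' && (up (lbranch o) && up (rbranch o))
  | Some (Some (inr x')), Some (Some (inl z')) =>
      is_root z' && is_root x' && (up (lbranch o) && up (rbranch o))
  | _, _ => false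
  end.
Proof.
have root_only b (x' z' : tree_vertex k)
    (i : tree_vertex k -> tree_vertex k + tree_vertex k) c :
    [&& is_root x' && b, is_root z' && b,
        Some (Some (i x')) != Some (Some (i z')) & c] = false.
  apply/and4P=> -[/andP[rx _] /andP[rz _] /eqP[]].
  by rewrite (root_uniq rx rz).
case: x z => [[[x|x]|]|] [[[z|z]|]|]; rewrite /immo /= ?oarc_None_r ?andbF //;
  rewrite ?root_only //;
  by try case: (is_root x); try case: (is_root z);
     case: (o.1); case: (up (lbranch o)); case: (up (rbranch o)).
Qed.

Arguments code {k} o.

(** Immoralities headed inside a branch are those of the branch, and those headed
    at c are recorded in [collisions]; so induction on the depth applies. *)
Lemma immo_code k (o1 o2 : orientation k) :
  (forall x y z, immo o1 x y z = immo o2 x y z) <-> code o1 = code o2.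
Proof.
elim: k o1 o2 => [|k IHk] o1 o2; first by split.
split=> [eqi|[]].
  have eL : code (lbranch o1) = code (lbranch o2).
    by apply/IHk => x y z; rewrite -!immo_inL.
  have eR : code (rbranch o1) = code (rbranch o2).
    by apply/IHk => x y z; rewrite -!immo_inR.
  rewrite /= eL eR; congr pair.
  (* Witnesses for the immoralities at c exist only if c has children; a leaf
     has no immorality. *)
  case: k o1 o2 eqi {IHk eL eR} => [|k] o1 o2 eqi.
    by rewrite /collisions /= !andbF.
  have := eqi None (Some None) (Some (Some (inl None))).
  have := eqi None (Some None) (Some (Some (inr None))).
  have := eqi (Some (Some (inl None))) (Some None) (Some (Some (inr None))).
  by rewrite /immo /collisions /= !andbT => -> -> ->.
move=> e1 e2 e3 /IHk eL /IHk eR.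
have{}eL x y z :
    immo o1 (inL x) (inL y) (inL z) = immo o2 (inL x) (inL y) (inL z).
  by rewrite !immo_inL.
have{}eR x y z :
    immo o1 (inR x) (inR y) (inR z) = immo o2 (inR x) (inR y) (inR z).
  by rewrite !immo_inR.
move=> x [[[y|y]|]|] z; last by rewrite !immo_None_mid.
- case: x z => [[[x|x]|]|] [[[z|z]|]|]; try by rewrite /immo /= ?andbF.
  + exact: (eL (Some x) (Some y) (Some z)).
  + exact: (eL (Some x) (Some y) None).
  + exact: (eL None (Some y) (Some z)).
- case: x z => [[[x|x]|]|] [[[z|z]|]|]; try by rewrite /immo /= ?andbF.
  + exact: (eR (Some x) (Some y) (Some z)).
  + exact: (eR (Some x) (Some y) None).
  + exact: (eR None (Some y) (Some z)).
by rewrite !immo_mid e1 e2 e3.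
Qed.

Lemma immA_code k (o1 o2 : orientation k) :
  immoralities (arcsA o1) = immoralities (arcsA o2) <-> code o1 = code o2.
Proof.
split=> [eqi|/immo_code eqi].
  by apply/immo_code=> x y z; rewrite -!in_immA eqi.
by apply/setP=> -[[x y] z]; rewrite !in_immA eqi.
Qed.

(** When c -> r, the vertex r heads no immorality and is a parent in
    none, so passing from [T k] to [A k] changes no immorality. *)
Lemma immo_up_Some k (o : orientation k) x y z :
  up o -> immo o x y z -> [&& x != None, y != None & z != None].
Proof.
move=> upo; case: y => [y|]; last by rewrite immo_None_mid.
rewrite /immo; case: x => [x|]; last by rewrite oarc_None_l upo /= andbF.
by case: z => // ; rewrite oarc_None_l upo /= !andbF.
Qed.

Lemma immT_code k (o1 o2 : orientation k) : up o1 -> up o2 ->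
  immoralities (arcsT o1) = immoralities (arcsT o2) <-> code o1 = code o2.
Proof.
move=> up1 up2; split=> [eqi|/immo_code eqi].
  apply/immo_code=> x y z.
  have [/and3P[]|nN] := boolP [&& x != None, y != None & z != None].
    by case: x y z => [x|] // [y|] // [z|] //; rewrite -!in_immT eqi.
  by apply/idP/idP => /immo_up_Some; rewrite (negbTE nN) => H; case: notF; exact: H.
by apply/setP=> -[[x y] z]; rewrite !in_immT eqi.
Qed.

(** * The counted families as sets of codes *)

Definition codes k b : {set code_type k} :=
  code @: [set o : orientation k | up o == b].

Lemma M_A k : M (A k) = #|codes k true :|: codes k false|.
Proof.
rewrite card_MECs_all (@card_MECs_code _ _ _ _ (@arcsA k) (@code k) predT).
- rewrite /codes -imsetU.
  have <- : [set o | predT o] = [set o : orientation k | up o == true] :|: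
      [set o : orientation k | up o == false]; last by [].
  by apply/setP=> o; rewrite !inE; case: (up o).
- by move=> o _; split; rewrite ?arcsA_dag.
- by move=> E /arcsA_surj[o <-] _; exists o.
- by move=> o1 o2 _ _; apply: immA_code.
Qed.

Lemma M_T k : M (T k.+1) = #|codes k.+1 true|.
Proof.
rewrite card_MECs_all (@card_MECs_code _ _ _ _ (@arcsT k.+1) (@code k.+1)
  (fun o => up o == true)) //.
- by move=> o _; split; rewrite ?arcsT_dag.
- by move=> E /arcsT_surj[o oup <-] _; exists o; rewrite ?oup.
- by move=> o1 o2 /eqP up1 /eqP up2; apply: immT_code.
Qed.

Lemma MX_code b n :
  MX b n.+2 = #|code @: [set o : orientation n.+2 |
     [&& up o == false, up (lbranch o) == ~~ b & up (rbranch o) == b]]|.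
Proof.
have XE (o : orientation n.+2) : (X_arcs n b \subset arcsA o) =
    [&& up o == false, up (lbranch o) == ~~ b & up (rbranch o) == b].
  rewrite !subUset !sub1set !inE /= /X_child.
  by case: b => /=; case: (o.1); case: (lbranch o).1; case: (rbranch o).1.
apply: (@card_MECs_code (A n.+2) (fun D => X_arcs n b \subset D) _ _ (@arcsA n.+2)).
- by move=> o; rewrite XE arcsA_dag.
- by move=> E /arcsA_surj[o <-]; rewrite XE; exists o.
- by move=> o1 o2 _ _; apply: immA_code.
Qed.

Lemma up_has_root k (o : orientation k) :
  up o -> exists x : tree_vertex k, is_root x.
Proof. by case: k o => // k o _; exists None. Qed.

Lemma MZ_code k :
  MZ k.+1 = #|code @: [set o : orientation k.+1 |
     [&& up o == false, up (lbranch o) == false & up (rbranch o) == false]]|.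
Proof.
have ZE (o : orientation k.+1) : Z_dag (arcsA o) =
    [&& up o == false, up (lbranch o) == false & up (rbranch o) == false].
  rewrite !eqbF_neg; apply/'forall_implyP/and3P => [Zo|[pF lF rF] _ /eqP->].
    have /andP[] := Zo None isT; rewrite arcA => pF /'forall_implyP cF.
    split; [exact: pF | |]; apply/negP=> upc; have [x rx] := up_has_root upc.
      by have := cF (Some (inl x)) rx; rewrite arcA /= oarc_None_l upc andbF.
    by have := cF (Some (inr x)) rx; rewrite arcA /= oarc_None_l upc andbF.
  apply/andP; split; first by rewrite arcA; exact: pF.
  apply/'forall_implyP => -[[x|x]|] // rx.
    by rewrite arcA /= oarc_None_l lF andbT.
  by rewrite arcA /= oarc_None_l rF andbT.
apply: (@card_MECs_code (A k.+1) (@Z_dag k.+1) _ _ (@arcsA k.+1)).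
- by move=> o; rewrite ZE arcsA_dag.
- by move=> E /arcsA_surj[o <-]; rewrite ZE; exists o.
- by move=> o1 o2 _ _; apply: immA_code.
Qed.

(** No recorded immorality uses the edge to the parent. *)
Definition parent_free k : pred (code_type k) :=
  match k return pred (code_type k) with
  | 0 => fun _ => true
  | k'.+1 => fun c => ~~ c.1.1.1 && ~~ c.1.1.2
  end.

Lemma immo_sym k (o : orientation k) x y z : immo o x y z = immo o z y x.
Proof.
by rewrite /immo andbCA eq_sym (edge_sym (x : A k)).
Qed.

Lemma parent_freeP k (o : orientation k) :
  reflect (forall y z, immo o None y z = false) (parent_free (code o)).
Proof.
case: k o => [|k] o; first by apply: (iffP idP).
apply: (iffP andP) => /= [[/negbTE pl /negbTE pr] y z|free].
  case: y => [[y|]|]; last by rewrite immo_None_mid.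
    by rewrite /immo; case: y => y.
  by rewrite immo_mid; case: z => [[[z|z]|]|]; rewrite ?pl ?pr ?andbF.
split; apply/negP=> pu; have /andP[_ /up_has_root[x rx]] := pu.
  by have := free (Some None) (inL (Some x)); rewrite immo_mid /= rx pu.
by have := free (Some None) (inR (Some x)); rewrite immo_mid /= rx pu.
Qed.

Lemma Y_dag_arcsT k (o : orientation k.+1) :
  Y_dag (arcsT o) = [&& ~~ (up (lbranch o) && up (rbranch o)),
    parent_free (code (lbranch o)) & parent_free (code (rbranch o))].
Proof.
apply/'forall_implyP/and3P => [Yo|[/negbTE nlr /parent_freeP fl /parent_freeP fr]].
  split.
  - apply/negP=> lr; have /andP[/up_has_root[x rx] /up_has_root[z rz]] := lr.
    have := Yo (Some (inl x), None, Some (inr z)).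
    by rewrite in_immT immo_mid rx rz lr => /(_ isT).
  - apply/parent_freeP=> y z; apply/negP=> yz.
    case: y z yz => [y|] [z|] yz; try by
      move: yz; rewrite ?immo_None_mid // /immo eqxx !andbF.
    have := Yo (None, Some (inl y), Some (inl z)); rewrite in_immT.
    by rewrite (immo_inL o None (Some y) (Some z)) => /(_ yz).
  - apply/parent_freeP=> y z; apply/negP=> yz.
    case: y z yz => [y|] [z|] yz; try by
      move: yz; rewrite ?immo_None_mid // /immo eqxx !andbF.
    have := Yo (None, Some (inr y), Some (inr z)); rewrite in_immT.
    by rewrite (immo_inR o None (Some y) (Some z)) => /(_ yz).
have no_parent y z : immo o (Some None) (Some y) (Some z) = false.
  case: y z => [[y|y]|] [[z|z]|]; try by rewrite /immo ?eqxx /= ?andbF.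
  - by rewrite (immo_inL o None (Some y) (Some z)) fl.
  - by rewrite (immo_inR o None (Some y) (Some z)) fr.
move=> [[x y] z]; rewrite in_immT => xyz; apply/negP=> /or3P[] /eqP e; move: xyz.
- by rewrite e no_parent.
- by rewrite e immo_mid; case: x z => [[x|x]|] [[z|z]|] //; rewrite nlr andbF.
- by rewrite e immo_sym no_parent.
Qed.

(** [Y_dag] depends only on the immoralities, so holding for all DAGs of a class
    is the same as holding for one of them. *)
Lemma MY_code k :
  MY k.+1 = #|code @: [set o : orientation k.+1 |
     [&& up o == true, ~~ (up (lbranch o) && up (rbranch o)),
         parent_free (code (lbranch o)) & parent_free (code (rbranch o))]]|.
Proof.
transitivity #|[set C in MECs (T k.+1) | [exists D in C, @Y_dag k.+1 D]]|.
  apply: eq_card => C; rewrite !inE; apply: andb_id2l => /imsetP[D dD ->].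
  have Yimm D' : D' \in [set E in dags (T k.+1) | markov_equiv D E] ->
      @Y_dag k.+1 D' = @Y_dag k.+1 D.
    by rewrite inE /Y_dag => /and3P[_ _ /eqP->].
  have DD : D \in [set E in dags (T k.+1) | markov_equiv D E].
    by rewrite inE dD /markov_equiv !eqxx.
  apply/forall_inP/exists_inP => [|[E EC YE] F FC]; first by exists D => //; auto.
  by rewrite Yimm // -(Yimm _ EC).
apply: (@card_MECs_code (T k.+1) (@Y_dag k.+1) _ _ (@arcsT k.+1)).
- by move=> o /andP[_]; rewrite -Y_dag_arcsT arcsT_dag.
- by move=> E /arcsT_surj[o oup <-]; rewrite Y_dag_arcsT; exists o; rewrite ?oup.
- by move=> o1 o2 /andP[/eqP up1 _] /andP[/eqP up2 _]; apply: immT_code.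
Qed.

(** * Recursive structure of the sets of codes *)

(** Once the three edges at c are directed, the branches are independent. *)
Lemma codes_block k b x y :
  code @: [set o : orientation k.+1 |
    [&& up o == b, up (lbranch o) == x & up (rbranch o) == y]]
  = setX [set collisions (~~ b) x y] (setX (codes k x) (codes k y)).
Proof.
apply/setP=> -[s [u v]]; rewrite !inE /=; apply/imsetP/and3P.
  move=> [[p [l r]]]; rewrite !inE /= => /and3P[/eqP-> /eqP eqx /eqP eqy] [-> -> ->].
  by rewrite eqx eqy; split=> //; apply: imset_f; rewrite inE ?eqx ?eqy.
case=> /eqP-> /imsetP[l]; rewrite inE => /eqP eqx -> /imsetP[r].
rewrite inE => /eqP eqy ->; exists (b, (l, r)); rewrite ?inE /= ?eqx ?eqy ?eqxx //.
Qed.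

Lemma codes0 b : codes 0 b = if b then set0 else [set tt].
Proof.
case: b; apply/setP=> -[]; rewrite !inE ?eqxx.
  by apply/negbTE/negP=> /imsetP[o]; rewrite inE.
by apply/imsetP; exists tt; rewrite ?inE.
Qed.

Lemma codesS k b : codes k.+1 b =
  \bigcup_x \bigcup_y setX [set collisions (~~ b) x y] (setX (codes k x) (codes k y)).
Proof.
apply/setP=> c; apply/imsetP/bigcupP.
  case=> o; rewrite inE => upo ->; exists (up (lbranch o)) => //.
  apply/bigcupP; exists (up (rbranch o)) => //.
  by rewrite -codes_block imset_f // inE upo !eqxx.
case=> x _ /bigcupP[y _]; rewrite -codes_block => /imsetP[o].
by rewrite inE => /and3P[upo _ _] ->; exists o; rewrite ?inE.
Qed.

Lemma in_codesS k b (s : bool * bool * bool) u v :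
  ((s, (u, v)) \in codes k.+1 b) =
  [|| [&& s == collisions (~~ b) true true, u \in codes k true & v \in codes k true],
      [&& s == collisions (~~ b) true false, u \in codes k true & v \in codes k false],
      [&& s == collisions (~~ b) false true, u \in codes k false & v \in codes k true] |
      [&& s == collisions (~~ b) false false,
          u \in codes k false & v \in codes k false]].
Proof.
have bigcup_bool (F : bool -> {set code_type k.+1}) :
    \bigcup_x F x = F true :|: F false.
  by rewrite -big_bool /=.
by rewrite codesS !bigcup_bool !inE /= !orbA.
Qed.

(** * Counting codes *)

Section PairCounts.
Variables (C : finType) (O I : {set C}).

(** Pairs of branch codes that can occur together with at most one branch
    pointing to c. *)
Definition free_pairs : {set C * C} :=
  [set p | [|| (p.1 \in I) && (p.2 \in I), (p.1 \in O) && (p.2 \in I)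
             | (p.1 \in I) && (p.2 \in O)]].

(** Inclusion-exclusion: a pair in (O u I)^2 that is not in [free_pairs] has both
    components outside I, hence lies in O x O. *)
Lemma card_free_pairs :
  #|free_pairs| + #|O| ^ 2 = #|O :|: I| ^ 2 + #|free_pairs :&: setX O O|.
Proof.
rewrite -!mulnn -!cardsX -cardsUI; congr (#|pred_of_set _| + _).
apply/setP=> -[u v]; rewrite !inE /=.
by do 4!case: (_ \in _).
Qed.

(** What [free_pairs] misses in O x O is the square of O minus I. *)
Lemma card_free_pairs_out :
  #|free_pairs :&: setX O O| + #|O :&: I| ^ 2 = 2 * #|O :&: I| * #|O|.
Proof.
have eD : setX O O :\: (free_pairs :&: setX O O) = setX (O :\: I) (O :\: I).
  apply/setP=> -[u v]; rewrite !inE /=.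
  by do 4!case: (_ \in _).
have := cardsID (free_pairs :&: setX O O) (setX O O).
rewrite setIC -setIA setIid eD !cardsX -(cardsID I O).
nia.
Qed.

End PairCounts.

(** A code realised with the top edge in both directions has no immorality on
    that edge. The realisation pointing down makes r a parent of c, so both
    children are then directed away from c; conversely the top edge of such an
    orientation can be reversed. *)
Lemma card_free_out k :
  #|codes k.+1 true :&: codes k.+1 false| = #|codes k false| ^ 2.
Proof.
rewrite -mulnn -cardsX.
rewrite -[RHS]mul1n -(cards1 (false, false, false)) -cardsX.
congr #|pred_of_set _|.
apply/setP=> -[[[p l] r] [u v]]; rewrite !(in_codesS, inE) /collisions /=.
by case: p l r => [] [] []; do 4!case: (_ \in _).
Qed.

Lemma card_setU_slice (J D : finType) (j : J) (P : {set D}) (B : {set J * D}) :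
  (forall d, (j, d) \notin B) -> #|setX [set j] P :|: B| = #|P| + #|B|.
Proof.
move=> jB; rewrite cardsU cardsX cards1 mul1n.
have -> : setX [set j] P :&: B = set0; last by rewrite cards0 subn0.
apply/setP=> -[i d]; rewrite !inE /=.
by case: eqP => //= ->; rewrite (negbTE (jB d)) andbF.
Qed.

(** When c -> r, only the two children of c can form an immorality at c. *)
Lemma card_codes_out k :
  #|codes k.+1 true| =
    #|codes k true| ^ 2 + #|free_pairs (codes k true) (codes k false)|.
Proof.
set F := free_pairs _ _.
have -> : codes k.+1 true = setX [set collisions false true true]
      (setX (codes k true) (codes k true)) :|:
    setX [set collisions false false false] F.
  apply/setP=> -[[[p l] r] [u v]]; rewrite !(in_codesS, inE) /collisions /=.
  by case: p l r => [] [] []; do 4!case: (_ \in _).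
rewrite card_setU_slice ?cardsX ?cards1 ?mul1n ?mulnn // => d.
by rewrite !inE.
Qed.

(** The codes with an immorality r -> c <- u for some child u of c; in order, both
    children, only the left one and only the right one point to c. *)
Definition parent_blocks k : {set code_type k.+1} :=
  setX [set collisions true true true] (setX (codes k true) (codes k true)) :|:
  (setX [set collisions true true false] (setX (codes k true) (codes k false)) :|:
   setX [set collisions true false true] (setX (codes k false) (codes k true))).

(** The three blocks have different root components, and [parent_free] excludes
    all three from B. *)
Lemma card_parent_blocks k (B : {set code_type k.+1}) :
    (forall c, c \in B -> parent_free c) ->
  #|parent_blocks k :|: B| =
    2 * (#|codes k true| * #|codes k false|) + #|codes k true| ^ 2 + #|B|.
Proof.
move=> freeB; have notB s d : ~~ (~~ s.1.1 && ~~ s.1.2) -> (s, d) \notin B.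
  by apply: contra => /freeB.
rewrite /parent_blocks -!setUA !card_setU_slice ?cardsX.
  by move: #|codes k true| #|codes k false| #|B| => t n m; nia.
all: by move=> d; rewrite ?inE /=; apply: notB.
Qed.

Lemma card_codes_in k :
  #|codes k.+1 false| =
    2 * (#|codes k true| * #|codes k false|) + #|codes k true| ^ 2
    + #|codes k false| ^ 2.
Proof.
pose B := setX [set collisions true false false] (setX (codes k false) (codes k false)).
have -> : codes k.+1 false = parent_blocks k :|: B.
  apply/setP=> -[[[p l] r] [u v]]; rewrite !(in_codesS, inE) /collisions /=.
  by case: p l r => [] [] []; do 4!case: (_ \in _).
rewrite card_parent_blocks ?cardsX ?cards1 ?mul1n ?mulnn // => -[s d].
by rewrite !inE /= => /andP[/eqP->].
Qed.

Lemma parent_free_out k c : c \in codes k.+1 true -> parent_free c.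
Proof. by case/imsetP=> o; rewrite inE /= => /eqP-> ->. Qed.

(** The codes realised only by a downward top edge have an immorality at c on
    it: without one, the edge can be reversed. *)
Lemma card_codes_all k :
  #|codes k.+1 true :|: codes k.+1 false| =
    #|codes k.+1 true| + 2 * (#|codes k true| * #|codes k false|)
    + #|codes k true| ^ 2.
Proof.
have -> : codes k.+1 true :|: codes k.+1 false = parent_blocks k :|: codes k.+1 true.
  apply/setP=> -[[[p l] r] [u v]]; rewrite !(in_codesS, inE) /collisions /=.
  by case: p l r => [] [] []; do 4!case: (_ \in _).
rewrite card_parent_blocks; last exact: parent_free_out.
by rewrite addnC addnA.
Qed.

(** If r -> c is in no immorality at c then c has r as its only parent, and
    reversing this arc preserves all immoralities. *)
Lemma parent_free_in k c : c \in codes k.+1 false -> parent_free c ->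
  c \in codes k.+1 true.
Proof.
case: c => -[[p l] r] [u v]; rewrite !in_codesS /collisions /=.
by case: p l r => [] [] []; do 4!case: (_ \in _).
Qed.

Lemma MX_codes b k : MX b k.+2 = #|codes k.+1 true| * #|codes k.+1 false|.
Proof.
by rewrite MX_code codes_block !cardsX cards1 mul1n; case: b; rewrite // mulnC.
Qed.

Lemma MZ_codes k : MZ k.+1 = #|codes k false| ^ 2.
Proof. by rewrite MZ_code codes_block !cardsX cards1 mul1n mulnn. Qed.

(** A branch code does not use the edge to c exactly when it can be realised with
    this edge pointing to c; so the two conditions on a Y-class are membership
    in [free_pairs] and in O x O. *)
Lemma MY_codes k :
  MY k.+2 = #|free_pairs (codes k.+1 true) (codes k.+1 false) :&:
              setX (codes k.+1 true) (codes k.+1 true)|.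
Proof.
set F := _ :&: _; rewrite MY_code.
have -> : #|F| = #|setX [set collisions false false false] F|.
  by rewrite cardsX cards1 mul1n.
have inC (o : orientation k.+1) : code o \in codes k.+1 (up o) by rewrite imset_f ?inE.
have outC (o : orientation k.+1) :
    parent_free (code o) = (code o \in codes k.+1 true).
  apply/idP/idP; last exact: parent_free_out.
  by have := inC o; case: (up o) => // inF; apply: parent_free_in.
have codeE (o : orientation k.+2) : code o =
    (collisions (~~ up o) (up (lbranch o)) (up (rbranch o)),
     (code (lbranch o), code (rbranch o))).
  by [].
congr #|pred_of_set _|; apply/setP=> -[s [u v]]; apply/imsetP/idP.
  case=> o; rewrite inE !outC => /and4P[/eqP upo nlr fl fr].
  rewrite codeE upo => -[-> -> ->].
  rewrite !in_setX /collisions /= (negbTE nlr) inE eqxx /=.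
  rewrite inE in_setX fl fr !andbT inE /=.
  have := inC (lbranch o); have := inC (rbranch o).
  move: nlr; case: (up (lbranch o)) (up (rbranch o)) => [] [] // _ -> ->;
    by rewrite ?orbT.
rewrite in_setX in_setI in_setX inE => /and3P[/eqP-> uv /andP[uO vO]].
(* Realise the pair with branches that do not both point to c; that each code
   can also be realised pointing to c already makes it [parent_free]. *)
suff [l [r [nlr ul vr]]] : exists l r : orientation k.+1,
    [/\ ~~ (up l && up r), u = code l & v = code r].
  pose o : orientation k.+2 := (true, (l, r)).
  have [eL eR] : lbranch o = l /\ rbranch o = r by [].
  exists o; last by rewrite codeE eL eR ul vr /collisions (negbTE nlr).
  by rewrite inE !outC eL eR -ul -vr uO vO nlr.
have codesP x w : w \in codes k.+1 x -> exists2 l, up l = x & w = code l.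
  by case/imsetP=> l; rewrite inE => /eqP; exists l.
move: uv; rewrite inE => /or3P[] /andP[/codesP[l ul uE] /codesP[r ur vE]];
  by exists l, r; split; rewrite ?ul ?ur.
Qed.

Lemma codes1 b : codes 1 b = [set (collisions false false false, (tt, tt))].
Proof.
apply/setP=> -[[[p l] r] [[] []]]; rewrite (@in_codesS 0) !codes0 /collisions /= !inE.
by rewrite !andbF !andbT !xpair_eqE !eqxx !andbT.
Qed.

Lemma MY1 : MY 1 = 1.
Proof.
rewrite MY_code -[RHS](cards1 (collisions false false false, (tt, tt))) -(codes1 true).
have -> // : [set o : orientation 1 | [&& up o == true,
      ~~ (up (lbranch o) && up (rbranch o)),
      parent_free (code (lbranch o)) & parent_free (code (rbranch o))]] =
    [set o : orientation 1 | up o == true].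
by apply/setP=> o; rewrite !inE /= !andbT.
Qed.

Local Open Scope ring_scope.

Theorem theorem4p5 (R : rcfType) (b : bool) :
  [/\ M (T 1) = 1%N /\
      (forall k : nat, (2 <= k)%N ->
        M (T k) = (M (A k.-1) ^ 2 + MY k)%N),
      M (A 1) = 1%N /\
      (forall k : nat, (2 <= k)%N ->
        M (A k) = (M (T k) + 2 * MX b k + M (T k.-1) ^ 2)%N),
      MX b 1 = 1%N /\
      (forall k : nat, (2 <= k)%N ->
        (MX b k)%:R = (M (T k.-1))%:R * Num.sqrt (MZ k)%:R :> R),
      MY 1 = 1%N /\
      (forall k : nat, (2 <= k)%N ->
        (MY k)%:Z =
          2 * (MZ k.-1)%:Z * (M (T k.-1))%:Z - (MZ k.-1)%:Z ^+ 2) &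
      (MZ 1 = 1%N /\ MZ 2 = 1%N) /\
      (forall k : nat, (3 <= k)%N ->
        MZ k = ((2 * MX b k.-1 + M (T k.-2) ^ 2 + MZ k.-1) ^ 2)%N)].
Proof.
split; split.
- by rewrite M_T codes1 cards1.
- case=> [|[|k]] // _; rewrite succnK M_T MY_codes M_A card_codes_out.
  by rewrite addnC card_free_pairs.
- by rewrite M_A !codes1 setUid cards1.
- by case=> [|[|k]] // _; rewrite succnK M_A !M_T MX_codes card_codes_all.
- by [].
- case=> [|[|k]] // _; rewrite succnK MX_codes MZ_codes M_T.
  by rewrite natrM natrX sqrtr_sqr ger0_norm ?ler0n.
- exact: MY1.
- case=> [|[|k]] // _; rewrite succnK MY_codes MZ_codes M_T -card_free_out.
  have := card_free_pairs_out (codes k.+1 true) (codes k.+1 false).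
  by lia.
- by rewrite !MZ_codes codes0 codes1 !cards1.
- case=> [|[|[|k]]] // _; rewrite !succnK !MZ_codes MX_codes M_T.
  by rewrite card_codes_in.
Qed.
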